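(* Let $A$ be a nonempty set, $G$ a group, $F:A\to\mathcal P(G)$ a soft group and $\tau$ a soft topology on $F$ such that $(F,\tau)$ is a soft paratopological group, and let $e_F\in\mathrm{SE}(F)$ be the identity selector. Then $(F,\tau)$ is a soft topological group if and only if, for every $\tau^\ast$-neighbourhood $U$ of $e_F$, the set $U\cap U^{-1}$ has nonempty interior in $(\mathrm{SE}(F),\tau^\ast)$.
   Context: A soft set over $G$ with parameter set $A$ is a map $F:A\to\mathcal P(G)$; it is a soft group if every $F(t)$ is a subgroup of $G$. $\mathrm{SE}(F)=\prod_{t\in A}F(t)$ is a group under pointwise multiplication $\ast$ and inversion; its identity is $e_F(t)=e$ for all $t$, where $e$ is the identity of $G$. A soft subset of $F$ is a map $H:A\to\mathcal P(G)$ with $H(t)\subseteq F(t)$ for all $t$; soft unions and intersections are parameterwise. A soft topology $\tau$ on $F$ is a family of soft subsets of $F$ containing $F$ and the empty soft set (all sections empty), closed under arbitrary soft unions and finite soft intersections. Component topology: $\tau_t=\{H(t):H\in\tau\}$ on $F(t)$. The selector (box) topology $\tau^\ast$ on $\mathrm{SE}(F)$ has base $\{\prod_{t\in A}U_t:U_t\in\tau_t\ \forall t\}$. $(F,\tau)$ is a soft paratopological group if $(a,b)\mapsto a\ast b$ is continuous from $\tau^\ast\times\tau^\ast$ to $\tau^\ast$; it is a soft topological group if in addition $a\mapsto a^{-1}$ is continuous on $(\mathrm{SE}(F),\tau^\ast)$. For $U\subseteq\mathrm{SE}(F)$, $U^{-1}=\{u^{-1}:u\in U\}$. *)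

(* Defs.v *)
From HB Require Import structures.
From mathcomp Require Import all_boot.
From mathcomp Require Import boolp classical_sets functions filter topology.

Set Implicit Arguments.
Unset Strict Implicit.
Unset Printing Implicit Defensive.

Local Open Scope classical_set_scope.

Notation soft_set A G := (A -> set G).

Definition soft_subset (A G : Type) (H F : soft_set A G) :=
  forall t, H t `<=` F t.

Definition is_subgroup (G : groupType) (S : set G) :=
  [/\ S 1%g, (forall x y, S x -> S y -> S (x * y)%g)
    & (forall x, S x -> S x^-1%g)].

Record soft_group (A : Type) (G : groupType) := SoftGroup {
  soft_group_set :> soft_set A G;
  soft_group_subgroup : forall t, is_subgroup (soft_group_set t) }.

(* Closure under finite soft intersections is given by the binary case      *)
(* together with membership of [F], which is the empty intersection of soft *)
(* subsets of [F].                                                          *)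
Record soft_topology (A G : Type) (F : soft_set A G) := SoftTopology {
  soft_open :> set (soft_set A G);
  soft_open_subset : forall H, soft_open H -> soft_subset H F;
  soft_open_full : soft_open F;
  soft_open_empty : soft_open (fun=> set0);
  soft_open_bigcup : forall S : set (soft_set A G), S `<=` soft_open ->
    soft_open (fun t => \bigcup_(H in S) H t);
  soft_openI : forall H K, soft_open H -> soft_open K ->
    soft_open (fun t => H t `&` K t) }.

Definition component_topology (A G : Type) (F : soft_set A G)
    (tau : soft_topology F) (t : A) : set (set G) :=
  [set H t | H in tau].

(* [F t], a set, is coerced here to the type of its elements. *)
Definition selector (A G : Type) (F : soft_set A G) := forall t : A, F t.

Section SelectorGroup.
Context {A : Type} {G : groupType} (F : soft_group A G).

HB.instance Definition _ := gen_eqMixin (selector F).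
HB.instance Definition _ := gen_choiceMixin (selector F).

Fact selector_one_subproof t : 1%g \in F t.
Proof. by apply: mem_set; case: (soft_group_subgroup F t). Qed.

Fact selector_mul_subproof (a b : selector F) t :
  (\val (a t) * \val (b t))%g \in F t.
Proof.
apply: mem_set; case: (soft_group_subgroup F t) => _ FM _.
by apply: FM; apply: set_mem; apply: valP.
Qed.

Fact selector_inv_subproof (a : selector F) t : ((\val (a t))^-1)%g \in F t.
Proof.
apply: mem_set; case: (soft_group_subgroup F t) => _ _ FV.
by apply: FV; apply: set_mem; apply: valP.
Qed.

Definition selector_one : selector F :=
  fun t => exist _ 1%g (selector_one_subproof t).

Definition selector_mul (a b : selector F) : selector F :=
  fun t => exist _ (\val (a t) * \val (b t))%g (selector_mul_subproof a b t).

Definition selector_inv (a : selector F) : selector F :=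
  fun t => exist _ (\val (a t))^-1%g (selector_inv_subproof a t).

Lemma selector_ext (a b : selector F) :
  (forall t, \val (a t) = \val (b t)) -> a = b.
Proof. by move=> ab; apply: functional_extensionality_dep => t; apply: val_inj. Qed.

Fact selector_mulA : associative selector_mul.
Proof. by move=> a b c; apply: selector_ext => t /=; rewrite mulgA. Qed.

Fact selector_mul1 : left_id selector_one selector_mul.
Proof. by move=> a; apply: selector_ext => t /=; rewrite mul1g. Qed.

Fact selector_mulr1 : right_id selector_one selector_mul.
Proof. by move=> a; apply: selector_ext => t /=; rewrite mulg1. Qed.

Fact selector_mulV : left_inverse selector_one selector_inv selector_mul.
Proof. by move=> a; apply: selector_ext => t /=; rewrite mulVg. Qed.

Fact selector_mulrV : right_inverse selector_one selector_inv selector_mul.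
Proof. by move=> a; apply: selector_ext => t /=; rewrite mulgV. Qed.

HB.instance Definition _ := isGroup.Build (selector F)
  selector_mulA selector_mul1 selector_mulr1 selector_mulV selector_mulrV.

End SelectorGroup.

(* The group SE(F), as a type carrying the box topology of [tau]. *)
Definition selector_space (A : Type) (G : groupType) (F : soft_group A G)
  (tau : soft_topology F) := selector F.

Definition selector_box (A G : Type) (F : soft_set A G) (U : soft_set A G) :
  set (selector F) := [set a | forall t, U t (\val (a t))].
Arguments selector_box {A G} F U.

Section SelectorTopology.
Context {A : Type} {G : groupType} {F : soft_group A G} (tau : soft_topology F).

HB.instance Definition _ := Group.on (selector_space tau).

Let box_index : set (A -> set G) :=
  [set U | forall t, component_topology tau t (U t)].

Fact selector_box_cover : \bigcup_(U in box_index) selector_box F U = setT.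
Proof.
apply/seteqP; split => // a _; exists (F : A -> set G).
  by move=> t; exists F => //; exact: soft_open_full.
by move=> t; apply: set_mem; apply: valP.
Qed.

Fact selector_box_join (U V : A -> set G) (a : selector_space tau) :
  box_index U -> box_index V -> selector_box F U a -> selector_box F V a ->
  exists W, [/\ box_index W, selector_box F W a
    & selector_box F W `<=` selector_box F U `&` selector_box F V].
Proof.
move=> HU HV Ua Va; exists (fun t => U t `&` V t); split.
- move=> t; have [H tH <-] := HU t; have [K tK <-] := HV t.
  by exists (fun t => H t `&` K t) => //; exact: soft_openI.
- by move=> t; split; [exact: Ua | exact: Va].
- by move=> b UVb; split => t; have [] := UVb t.
Qed.

HB.instance Definition _ := isBaseTopological.Build (selector_space tau)
  selector_box_cover selector_box_join.

End SelectorTopology.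

Definition is_soft_paratopological_group (A : Type) (G : groupType)
    (F : soft_group A G) (tau : soft_topology F) :=
  continuous (fun ab : selector_space tau * selector_space tau =>
    (ab.1 * ab.2)%g : selector_space tau).

Definition is_soft_topological_group (A : Type) (G : groupType)
    (F : soft_group A G) (tau : soft_topology F) :=
  is_soft_paratopological_group tau /\
  continuous (fun a : selector_space tau => a^-1%g : selector_space tau).

(* Main.v *)
Require Import Defs.
From HB Require Import structures.
From mathcomp Require Import all_boot.
From mathcomp Require Import boolp classical_sets functions filter topology.

Local Open Scope classical_set_scope.

(** Given a neighbourhood [U] of 1, choose a neighbourhood [V] of 1 with
    [V V] contained in [U], and a point [x] in the interior [W] of the
    intersection of [V] and [V^-1]. Then [x^-1 W] is a neighbourhood of 1
    contained in [V^-1 V^-1], hence in [U^-1]. So inversion is continuous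
    at 1, and translations carry this to every point. *)

Section Paratopological.
Context {A : Type} {G : groupType} {F : soft_group A G}.
Context {tau : soft_topology F}.
Hypothesis tau_para : is_soft_paratopological_group tau.
Local Notation T := (selector_space tau).
Implicit Types (a b x : T) (U V : set T).

(** Joint continuity, restricted to the slice with first coordinate [a], makes left translation by
    [a] continuous. *)
Lemma nbhs_preimage_mulgl a b U :
  nbhs ((a * b)%g : T) U -> nbhs b [set y : T | U (a * y)%g].
Proof.
move=> /(tau_para (a, b)) [[P Q] /= [Pa Qb] PQ].
by apply: filterS Qb => y Qy; apply: (PQ (a, y)); split => //=;
  exact: nbhs_singleton.
Qed.

Lemma nbhs_preimage_mulgr a b U :
  nbhs ((a * b)%g : T) U -> nbhs a [set y : T | U (y * b)%g].
Proof.
move=> /(tau_para (a, b)) [[P Q] /= [Pa Qb] PQ].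
by apply: filterS Pa => y Py; apply: (PQ (y, b)); split => //=;
  exact: nbhs_singleton.
Qed.

Lemma nbhs1_mul_split U : nbhs (1%g : T) U ->
  exists2 V, nbhs (1%g : T) V & forall x y : T, V x -> V y -> U (x * y)%g.
Proof.
move=> U1; have : nbhs ((1 * 1)%g : T) U by rewrite mulg1.
move=> /(tau_para (1%g, 1%g)) [[P Q] /= [P1 Q1] PQ].
exists (P `&` Q); first exact: filterI.
by move=> x y [Px _] [_ Qy]; exact: (PQ (x, y)).
Qed.

(** Since [x^-1 = (a^-1 * x)^-1 * a^-1], inversion near [a] is a left translation taking [a] to 1,
    then inversion near 1, then a right translation. *)
Lemma continuous_invg_at1 :
  (forall U, nbhs (1%g : T) U -> nbhs (1%g : T) [set y : T | U y^-1%g]) ->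
  continuous (fun a : T => a^-1%g : T).
Proof.
move=> inv1 a U; rewrite nbhs_filterE => Ua.
have /inv1 U1 : nbhs (1%g : T) [set y : T | U (y * a^-1)%g].
  by apply: (nbhs_preimage_mulgr 1%g a^-1%g U); rewrite mul1g.
have : nbhs a [set x : T | U ((a^-1 * x)^-1 * a^-1)%g].
  by apply: (nbhs_preimage_mulgl a^-1%g a [set y : T | U (y^-1 * a^-1)%g]); rewrite mulVg.
by apply: filterS => x /=; rewrite invgM invgK mulgK.
Qed.

Lemma nbhs1_preimage_invg :
  (forall U, nbhs (1%g : T) U ->
    (U `&` [set (u^-1)%g | u in U])° !=set0) ->
  forall U, nbhs (1%g : T) U -> nbhs (1%g : T) [set y : T | U y^-1%g].
Proof.
move=> int_ne U /nbhs1_mul_split [V /int_ne [x Wx] VVU].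
have [Vx _] := nbhs_singleton Wx.
(* Left translation by [x] sends 1 to the interior point [x], so this preimage is a neighbourhood of
   1. *)
have : nbhs (1%g : T) [set y : T | (V `&` [set (u^-1)%g | u in V]) (x * y)%g].
  by apply: (nbhs_preimage_mulgl x 1%g (V `&` _)); rewrite mulg1.
apply: filterS => y /= [_ [v Vv vE]].
(* Here [x * y = v^-1] with [v] and [x] both in [V]. *)
suff -> : (y^-1 = v * x)%g by exact: VVU.
by rewrite -[v]invgK vE invgM mulgVK.
Qed.

End Paratopological.

Theorem theorem4p9 (A : Type) (G : groupType) (F : soft_group A G)
    (tau : soft_topology F) (A_nonempty : inhabited A)
    (tau_para : is_soft_paratopological_group tau) :
  is_soft_topological_group tau <->
  (forall U : set (selector_space tau),
    nbhs (1%g : selector_space tau) U ->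
    (U `&` [set (u^-1)%g | u in U])° !=set0).
Proof.
split=> [[_ invC] U U1|int_ne]; last first.
  by split=> //; apply: continuous_invg_at1 => //; exact: nbhs1_preimage_invg.
(* The identity is interior: by continuity of inversion at 1, the inverse of [U] is also a
   neighbourhood of 1. *)
exists 1%g; apply: filterI => //.
have : nbhs (1%g : selector_space tau) [set y : selector_space tau | U y^-1%g].
  by apply: (invC 1%g); rewrite invg1.
by apply: filterS => y Uy; exists y^-1%g => //; rewrite invgK.
Qed.
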